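(* There is no Borel probability measure $\nu$ on $[0,1]$ that is simultaneously invariant with respect to $T$, ergodic with respect to $T$, and absolutely continuous with respect to Lebesgue measure.
   Context: Every irrational $x\in(0,1)$ has a unique representation ($\bar O^1$-expansion) $$x=\sum_{k=1}^\infty\frac{(-1)^{k-1}}{g_1(g_1+g_2)\cdots(g_1+g_2+\dots+g_k)}=:\bar O^1(g_1,g_2,\dots),\qquad g_k=g_k(x)\in\mathbb{N},$$ and every infinite sequence of positive integers yields an irrational number in $(0,1)$ this way. The shift $T$ is defined (on irrationals of $(0,1)$, a set of full Lebesgue measure) by $T(\bar O^1(g_1,g_2,g_3,\dots))=\bar O^1(g_2,g_3,\dots)$. A measure $\nu$ is $T$-invariant if $\nu(T^{-1}E)=\nu(E)$ for every Borel set $E$; it is $T$-ergodic if every Borel set $A$ with $T^{-1}A=A$ has $\nu(A)=0$ or $\nu(A)=1$. *)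

(* Defs.v *)
From HB Require Import structures.
From mathcomp Require Import all_boot all_order all_algebra.
From mathcomp Require Import all_classical all_reals all_analysis.
Set Implicit Arguments. Unset Strict Implicit. Unset Printing Implicit Defensive.
Import Order.TTheory GRing.Theory Num.Theory.
Import numFieldNormedType.Exports.
Local Open Scope classical_set_scope.
Local Open Scope ring_scope.

(* A sequence of positive integers (g_1, g_2, ...) is represented by
   g : nat -> nat with g k = g_{k+1} and 0 < g k. *)
Definition posseq (g : nat -> nat) : Prop := forall k, (0 < g k)%N.

Definition Obar_term {R : realType} (g : nat -> nat) (k : nat) : R :=
  (-1) ^+ k / \prod_(i < k.+1) (\sum_(j < i.+1) g j)%:R.

Definition Obar {R : realType} (g : nat -> nat) : R :=
  limn (series (@Obar_term R g)).

Definition irrational {R : realType} (x : R) : Prop :=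
  ~ exists q : rat, x = ratr q.

(* The digit sequence of x: the (unique, by the paper's context) positive
   sequence g with Obar g = x, when one exists; junk otherwise. *)
Definition Odigits {R : realType} (x : R) : nat -> nat :=
  match pselect (exists g, posseq g /\ @Obar R g = x) with
  | left h => proj1_sig (cid h)
  | right _ => fun _ => 1%N
  end.

(* The shift T(Obar(g_1,g_2,g_3,...)) = Obar(g_2,g_3,...) on irrationals of
   (0,1); set to 0 elsewhere (a Lebesgue-null set). *)
Definition Tshift {R : realType} (x : R) : R :=
  if `[< irrational x /\ 0 < x < 1 >] then @Obar R (fun k => Odigits x k.+1)
  else 0.

Definition T_invariant {R : realType}
  (nu : set (measurableTypeR R) -> \bar R) : Prop :=
  forall E : set (measurableTypeR R), measurable E ->
    nu (Tshift @^-1` E) = nu E.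

Definition T_ergodic {R : realType}
  (nu : set (measurableTypeR R) -> \bar R) : Prop :=
  forall A : set (measurableTypeR R), measurable A ->
    Tshift @^-1` A = A -> nu A = 0%E \/ nu A = 1%E.

(* Main.v *)
(** Up to the normalisation q_k = g_1 + ... + g_k, the O^1-expansion is the
    Pierce expansion, generated by x |-> 1 - floor(1/x) x. Along it, the
    Lebesgue measure of {g_(n+1) = i} is at most 2^-n / 2, so by Borel-Cantelli
    almost every x has each digit i only finitely often. If nu is invariant and
    absolutely continuous, then nu {g_n = i} does not depend on n, while
    nu {g_m = i for some m >= n} tends to nu (limsup {g_n = i}) = 0. Hence
    nu {g_1 = i} = 0 for every i, and nu vanishes on the irrationals. *)

Require Import Defs.
From HB Require Import structures.
From mathcomp Require Import all_boot all_order all_algebra.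
From mathcomp Require Import all_classical all_reals all_analysis.
From mathcomp Require Import measurable_realfun lra ring.
Import Order.TTheory GRing.Theory Num.Theory.
Import numFieldNormedType.Exports.
(* [mathcomp.reals] also exports an [irrational], which would shadow ours. *)
Import Defs.
Local Open Scope classical_set_scope.
Local Open Scope ring_scope.

Definition shift (g : nat -> nat) : nat -> nat := fun k => g k.+1.

Lemma posseq_shift g : posseq g -> posseq (shift g).
Proof. by move=> g_gt0 k; exact: g_gt0. Qed.

(** * Pierce series with an offset, and existence of the expansion *)

Section PierceSeries.
Context {R : realType}.
Implicit Types (s n : nat) (g : nat -> nat) (x : R).

Definition pierce_term s g (k : nat) : R :=
  (-1) ^+ k / \prod_(i < k.+1) (s + \sum_(j < i.+1) g j)%:R.

(* The alternating series with denominators q_k = s + g_1 + ... + g_k; the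
   offset s makes the family stable under removal of the first term. *)
Definition pierce s g : R := limn (series (pierce_term s g)).

Lemma Obar_pierce g : Obar g = pierce 0 g.
Proof. by []. Qed.

Lemma pierce_term0 s g : pierce_term s g 0 = (s + g 0%N)%:R^-1.
Proof. by rewrite /pierce_term !big_ord1 expr0 mul1r. Qed.

Lemma pierce_termS s g k :
  pierce_term s g k.+1 =
  - (pierce_term (s + g 0%N) (shift g) k / (s + g 0%N)%:R).
Proof.
rewrite /pierce_term big_ord_recl big_ord1 exprS mulN1r mulNr; congr (- _).
rewrite -mulrA -invfM [X in _ / X = _]mulrC; congr (_ / (_ * _)).
by apply: eq_bigr => i _; rewrite big_ord_recl addnA.
Qed.

Lemma pierce_series_S s g n :
  series (pierce_term s g) n.+1 =
  (1 - series (pierce_term (s + g 0%N) (shift g)) n) / (s + g 0%N)%:R.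
Proof.
rewrite /series/= big_nat_recl// pierce_term0 mulrBl mul1r; congr (_ + _).
by rewrite mulr_suml -sumrN; apply: eq_bigr => k _; rewrite pierce_termS.
Qed.

Lemma pierce_term_le s g k : posseq g ->
  `|pierce_term s g k| <= geometric 2 2^-1 k.
Proof.
(* A positive offset makes every denominator at least 2, so each factor gains 1/2. With offset 0 the
   first denominator may be 1; the constant 2 absorbs this. *)
have claim t h j : (0 < t)%N -> posseq h -> `|pierce_term t h j| <= 2^-1 ^+ j.
  elim: j t h => [|j ih] t h t0 h0.
    rewrite pierce_term0 expr0 normfV normr_nat invf_le1 ?ltr0n ?ler1n//.
      by rewrite addn_gt0 t0.
    by rewrite addn_gt0 t0.
  rewrite pierce_termS normrN normrM normfV normr_nat exprSr.
  apply: ler_pM; rewrite ?invr_ge0//.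
    by rewrite ih ?addn_gt0 ?t0//; exact: posseq_shift.
  rewrite lef_pV2 ?posrE ?ltr0n ?addn_gt0 ?t0// ler_nat.
  by rewrite -[2%N]/(1 + 1)%N leq_add// h0.
move=> g0; have q0 : (0 < s + g 0%N)%N by rewrite addn_gt0 g0 orbT.
have q1 : (s + g 0%N)%:R^-1 <= 1 :> R by rewrite invf_le1 ?ltr0n ?ler1n.
case: k => [|k].
  by rewrite pierce_term0 normfV normr_nat /= expr0; lra.
rewrite pierce_termS normrN normrM normfV normr_nat /= exprS mulrA divff//.
rewrite mul1r -[leRHS]mulr1; apply: ler_pM; rewrite ?invr_ge0//.
by apply: claim => //; exact: posseq_shift.
Qed.

Lemma is_cvg_pierce s g : posseq g -> cvgn (series (pierce_term s g)).
Proof.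
move=> g0; apply: normed_cvg; apply: (@series_le_cvg R _ (geometric 2 2^-1)).
- by move=> n /=.
- by move=> n; rewrite /= mulr_ge0// exprn_ge0// invr_ge0.
- by move=> n; exact: pierce_term_le.
- by apply: is_cvg_geometric_series; rewrite ger0_norm//; lra.
Qed.

(** Solved for the tail: with [q = s + g 0], the map [x |-> 1 - q * x] strips the first digit and
    turns the offset into [q]. *)
Lemma pierce_rec s g : posseq g ->
  pierce s g = (1 - pierce (s + g 0%N) (shift g)) / (s + g 0%N)%:R.
Proof.
move=> g0; apply/cvg_lim => //; rewrite -cvg_shiftS/=.
under eq_fun do rewrite pierce_series_S.
apply: cvgMl; apply: cvgB; first exact: cvg_cst.
by apply: is_cvg_pierce; exact: posseq_shift.
Qed.

Lemma pierce01 s g : posseq g -> 0 <= pierce s g <= 1.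
Proof.
have psum01 n t h : posseq h -> 0 <= series (pierce_term t h) n <= 1.
  elim: n t h => [|n ih] t h h0.
    by rewrite /series/= big_geq// lexx ler01.
  rewrite pierce_series_S; have := ih (t + h 0%N)%N _ (posseq_shift _ h0).
  set u := series _ _; move=> /andP[u0 u1].
  have q0 : (0 < t + h 0%N)%N by rewrite addn_gt0 h0 orbT.
  rewrite divr_ge0 ?subr_ge0//= ler_pdivrMr ?ltr0n// mul1r.
  by apply: (@le_trans _ _ 1); [lra|rewrite ler1n].
move=> g0; apply/andP; split.
- apply: limr_ge; first exact: is_cvg_pierce.
  by apply: nearW => n; have /andP[] := psum01 n s g g0.
- apply: limr_le; first exact: is_cvg_pierce.
  by apply: nearW => n; have /andP[] := psum01 n s g g0.
Qed.

(** Makes the first digit readable from the value. The bounds bootstrap through [pierce_rec]: a weak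
    upper bound on the tail gives positivity, positivity gives the strict upper bound, and that
    bound on the tail gives the lower one. *)
Lemma pierce_itv s g : posseq g ->
  pierce s g \in `](s + g 0%N).+1%:R^-1, (s + g 0%N)%:R^-1[.
Proof.
have qgt0 t h : posseq h -> 0 < (t + h 0%N)%:R :> R.
  by move=> h0; rewrite ltr0n addn_gt0 h0 orbT.
have le_inv t h : posseq h -> pierce t h <= (t + h 0%N)%:R^-1.
  move=> h0; rewrite pierce_rec// ler_pdivrMr ?qgt0// mulVf ?gt_eqF ?qgt0//.
  have /andP[+ _] := pierce01 (t + h 0%N) _ (posseq_shift _ h0); lra.
have gt0 t h : posseq h -> 0 < pierce t h.
  move=> h0; rewrite pierce_rec// divr_gt0 ?qgt0// subr_gt0.
  apply: le_lt_trans (le_inv _ _ (posseq_shift _ h0)) _.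
  rewrite invf_lt1 ?qgt0//; last exact: posseq_shift.
  by rewrite ltr1n -[2%N]/(1 + 1)%N leq_add// ?h0// addn_gt0 h0 orbT.
have lt_inv t h : posseq h -> pierce t h < (t + h 0%N)%:R^-1.
  move=> h0; rewrite pierce_rec// ltr_pdivrMr ?qgt0// mulVf ?gt_eqF ?qgt0//.
  have := gt0 (t + h 0%N) _ (posseq_shift _ h0); lra.
move=> g0; rewrite in_itv/= lt_inv// andbT pierce_rec//.
have y_lt : pierce (s + g 0%N) (shift g) < (s + g 0%N).+1%:R^-1.
  apply: lt_le_trans (lt_inv _ _ (posseq_shift _ g0)) _.
  rewrite lef_pV2 ?posrE ?ltr0n ?addn_gt0 ?g0 ?orbT//.
  by rewrite ler_nat -addn1 leq_add2l g0.
rewrite ltr_pdivlMr ?qgt0//.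
have := qgt0 s g g0; move: y_lt; rewrite -natr1; set q := (s + _)%:R.
move=> y_lt q0; have : (q + 1)^-1 * (q + 1) = 1 by rewrite mulVf//; lra.
by rewrite mulrDr mulr1; lra.
Qed.

(* The map y |-> (1 - y) / q contracts by 1/q <= 1/2 from the second step on. *)
Lemma pierce_orbit_uniq (q : nat -> nat) (y z : nat -> R) :
  (forall k, (k < q k)%N) ->
  (forall k, 0 <= y k <= 1) -> (forall k, 0 <= z k <= 1) ->
  (forall k, y k = (1 - y k.+1) / (q k)%:R) ->
  (forall k, z k = (1 - z k.+1) / (q k)%:R) -> y 0%N = z 0%N.
Proof.
move=> qk y01 z01 yE zE.
have dE k : `|y k - z k| = `|y k.+1 - z k.+1| / (q k)%:R.
  rewrite yE zE -mulrBl normrM normfV normr_nat distrC; congr (`|_| / _); lra.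
have d_le n k : `|y k.+1 - z k.+1| <= geometric 1 2^-1 n.
  elim: n k => [|n ih] k /=.
    rewrite expr0 mul1r ler_norml; have := y01 k.+1; have := z01 k.+1; lra.
  rewrite dE; have := ih k.+1; rewrite /= !mul1r exprSr => {}ih.
  apply: ler_pM; rewrite ?invr_ge0// lef_pV2 ?posrE ?ltr0n ?ler_nat//.
    exact: leq_ltn_trans (qk k.+1).
  by apply: leq_trans (qk k.+1).
have d1 : `|y 1%N - z 1%N| <= 0.
  apply: (cvgr_to_ge (f := geometric 1 2^-1) (F := \oo)).
    by apply: cvg_geometric; rewrite ger0_norm//; lra.
  by apply: nearW => n; exact: d_le.
apply/eqP; rewrite -subr_eq0 -normr_eq0 dE.
by move: d1; rewrite normr_le0 => /eqP ->; rewrite normr0 mul0r.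
Qed.

Lemma irrational_subM (r : nat) x : (0 < r)%N ->
  irrational x -> irrational (1 - r%:R * x).
Proof.
move=> r0 irrx [q xq]; apply irrx; exists ((1 - q) / r%:R).
rewrite fmorph_div/= rmorphB/= rmorph1 ratr_nat -xq opprB addrC subrK.
by rewrite mulrAC divff ?mul1r// pnatr_eq0 -lt0n.
Qed.

Lemma irrational_trunc x : irrational x -> 0 < x < 1 ->
  let r := Num.truncn x^-1 in
  (0 < r)%N /\ x \in `]r.+1%:R^-1, r%:R^-1[.
Proof.
move=> irrx /andP[x0 x1] r.
have r0 : (0 < r)%N by rewrite truncn_gt0 invf_ge1// ltW.
have /truncn_itv/andP[rx xr] : 0 <= x^-1 by rewrite invr_ge0 ltW.
split=> //; rewrite in_itv/=; apply/andP; split.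
  by rewrite invf_plt ?posrE.
(* Irrationality excludes the endpoint [1/r]. *)
rewrite lt_neqAle; apply/andP; split.
  apply/eqP => xE; apply irrx; exists (r%:R^-1 : rat).
  by rewrite xE fmorphV/= ratr_nat.
by rewrite -[x]invrK lef_pV2 ?posrE ?invr_gt0 ?ltr0n.
Qed.

(** Greedy algorithm: iterate [x |-> 1 - floor(1/x) * x] and take the increments of the floors [q k]
    as digits. The orbit and the tails of the resulting series obey the same recursion, so
    contraction identifies them. *)
Lemma irrational_Obar x : irrational x -> 0 < x < 1 ->
  exists g, posseq g /\ Obar g = x.
Proof.
move=> irrx x01.
have [y y0 yS] : exists2 y : nat -> R, y 0%N = x &
    forall k, y k.+1 = 1 - (Num.truncn (y k)^-1)%:R * y k.
  by exists (fun k => iter k (fun z => 1 - (Num.truncn z^-1)%:R * z) x).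
pose q k := Num.truncn (y k)^-1.
have {}yS k : y k.+1 = 1 - (q k)%:R * y k by exact: yS.
have yP k : irrational (y k) /\ 0 < y k < 1.
  elim: k => [|k [irrk k01]]; first by rewrite y0.
  have [q0 yk] := irrational_trunc _ irrk k01; rewrite -/(q k) in q0 yk.
  split; first by rewrite yS; exact: irrational_subM.
  move: yk; rewrite in_itv/= yS => /andP[_ yq].
  have q0' : 0 < (q k)%:R :> R by rewrite ltr0n.
  have : (q k)%:R * y k < 1 by rewrite mulrC -ltr_pdivlMr// mul1r.
  have : 0 < (q k)%:R * y k by rewrite mulr_gt0//; lra.
  lra.
have q_gt0 k : (0 < q k)%N.
  by have [irrk k01] := yP k; have [] := irrational_trunc _ irrk k01.
have qr0 k : 0 < (q k)%:R :> R by rewrite ltr0n.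
have y_itv k : y k \in `](q k).+1%:R^-1, (q k)%:R^-1[.
  by have [irrk k01] := yP k; have [] := irrational_trunc _ irrk k01.
(* From [y k > 1/(q k + 1)] follows [y k.+1 < 1/(q k + 1)], which forces a larger floor; hence the
   increments are positive. *)
have q_incr k : (q k < q k.+1)%N.
  have yk1 : y k.+1 < (q k).+1%:R^-1.
    have := y_itv k; rewrite yS in_itv/= => /andP[+ _].
    rewrite -natr1; have := qr0 k; set a := (q k)%:R => a0 ay.
    have : (a + 1)^-1 * (a + 1) = 1 by rewrite mulVf//; lra.
    have : a * (a + 1)^-1 < a * y k by rewrite ltr_pM2l.
    rewrite mulrDr mulr1; lra.
  have := y_itv k.+1; rewrite in_itv/= => /andP[yk2 _].
  by move: (lt_trans yk2 yk1); rewrite ltf_pV2 ?posrE ?ltr0n// ltr_nat ltnS.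
have q_ge k : (k < q k)%N.
  by elim: k => [//|k ih]; exact: leq_ltn_trans ih (q_incr k).
pose g k := if k is k'.+1 then (q k - q k')%N else q 0%N.
have g0 : posseq g by case=> [|k]; rewrite /g ?subn_gt0.
exists g; split => //; rewrite Obar_pierce.
(* Tail of the series from index [k]; its offset is the previous floor, or 0 at the start. *)
pose z k := pierce (if k is k'.+1 then q k' else 0%N) (fun j => g (k + j)%N).
have gk0 k : posseq (fun j => g (k + j)%N) by move=> j; exact: g0.
have zE k : z k = (1 - z k.+1) / (q k)%:R.
  rewrite /z pierce_rec// addn0.
  have -> : ((if k is k'.+1 then q k' else 0) + g k = q k)%N.
    by case: k => [|k]; rewrite /g ?add0n// subnKC// ltnW.
  congr ((1 - pierce _ _) / _); apply/funext => j.
  by rewrite /shift addnS addSn.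
rewrite -y0; apply: (@pierce_orbit_uniq q z y) => //.
- by move=> k; exact: pierce01.
- by move=> k; have [_] := yP k; lra.
- by move=> k; rewrite yS opprB addrC subrK mulrAC divff ?mul1r// gt_eqF.
Qed.

End PierceSeries.

(** * Lebesgue measure under decreasing affine maps *)

Section AffineLebesgue.
Context {R : realType}.
Implicit Types (a b : R) (A : set (measurableTypeR R)).

Lemma measurable_affine a b :
  measurable_fun setT
    (fun x : measurableTypeR R => (a - b * x : measurableTypeR R)).
Proof. by apply: measurable_funB => //; exact: measurable_funM. Qed.

Lemma preimage_affine_itvoc a b (u v : R) : 0 < b ->
  (fun x => a - b * x) @^-1` `]u, v] = `[(a - v) / b, (a - u) / b[%classic.
Proof.
move=> b0; apply/seteqP; split=> x /=; rewrite !in_itv/=.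
  by rewrite ler_pdivrMr// ltr_pdivlMr// [x * b]mulrC => /andP[? ?]; lra.
by rewrite ler_pdivrMr// ltr_pdivlMr// [x * b]mulrC => /andP[? ?]; lra.
Qed.

(** By uniqueness of Lebesgue measure: [b] times the pushforward gives half-open intervals their
    length. *)
Lemma lebesgue_measure_affine a b A : 0 < b -> measurable A ->
  lebesgue_measure ((fun x => a - b * x) @^-1` A) =
  (b^-1%:E * lebesgue_measure A)%E.
Proof.
move=> b0 mA; pose f (x : measurableTypeR R) : measurableTypeR R := a - b * x.
have mf : measurable_fun setT f by exact: measurable_affine.
pose b' : {nonneg R} := NngNum (ltW b0).
pose nu := mscale b' (pushforward (@lebesgue_measure R) f).
have -> : lebesgue_measure A = nu mf A.
  apply: (@lebesgue_measure_unique R (nu mf)) => // _ [[u v]/= uv <-].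
  rewrite /nu /mscale/= /pushforward/= preimage_affine_itvoc//.
  rewrite !lebesgue_measure_itv/= !lte_fin ltr_pM2r ?invr_gt0//.
  rewrite ltrD2l ltrN2; case: ifPn => _; last by rewrite mule0.
  by rewrite -!EFinB -EFinM; congr (_%:E); field; rewrite gt_eqF.
by rewrite /nu /mscale/= muleA -EFinM mulVf ?gt_eqF// mul1e.
Qed.

End AffineLebesgue.

(** * Sets with a prescribed digit and their Lebesgue measure *)

Section DigitSets.
Context {R : realType}.
Implicit Types (d n s : nat) (g : nat -> nat) (x : R).

(* [digit_set d n s] contains [pierce s g] exactly when [g n = d.+1]. It is
   built from intervals and affine preimages so that its measurability and its
   Lebesgue measure can be read off. *)
Fixpoint digit_set d n s : set (measurableTypeR R) :=
  if n is n'.+1 then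
    \bigcup_j (`](s + j).+2%:R^-1, (s + j).+1%:R^-1[ `&`
      (fun x : R => 1 - (s + j).+1%:R * x) @^-1` digit_set d n' (s + j).+1)
  else `](s + d).+2%:R^-1, (s + d).+1%:R^-1[%classic.

Lemma measurable_digit_set d n s : measurable (digit_set d n s).
Proof.
elim: n s => [|n ih] s /=; first exact: measurable_itv.
apply: bigcupT_measurable => j; apply: measurableI; first exact: measurable_itv.
rewrite -[X in measurable X]setTI.
by apply: (measurable_affine 1 (s + j).+1%:R) => //; exact: ih.
Qed.

Lemma digit_set_sub01 d n s : digit_set d n s `<=` `]0, 1[.
Proof.
have itv01 r : `]r.+2%:R^-1, r.+1%:R^-1[ `<=` `]0 : R, 1[.
  move=> x /=; rewrite !in_itv/= => /andP[rx xr].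
  rewrite (lt_trans _ rx) ?invr_gt0//= (lt_le_trans xr)//.
  by rewrite invf_le1 ?ler1n.
by case: n => [|n] /=; [exact: itv01|move=> x [j _ [+ _]]; exact: itv01].
Qed.

Lemma inv_itv_inj (q r : nat) x : (0 < q)%N -> (0 < r)%N ->
  x \in `]q.+1%:R^-1, q%:R^-1[ -> x \in `]r.+1%:R^-1, r%:R^-1[ -> q = r.
Proof.
have lt_le a b : (0 < a)%N -> (0 < b)%N -> x \in `]a.+1%:R^-1, a%:R^-1[ ->
    x \in `]b.+1%:R^-1, b%:R^-1[ -> (a <= b)%N.
  rewrite !in_itv/= => a0 b0 /andP[_ xa] /andP[bx _].
  by move: (lt_trans bx xa); rewrite ltf_pV2 ?posrE ?ltr0n// ltr_nat ltnS.
move=> q0 r0 xq xr; apply/eqP; rewrite eqn_leq.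
by apply/andP; split; exact: lt_le.
Qed.

Lemma pierce_digit_set d n s g : posseq g ->
  digit_set d n s (pierce s g) <-> g n = d.+1.
Proof.
elim: n s g => [|n ih] s g g0 /=; have := pierce_itv (R := R) s g g0;
  have q0 : (0 < s + g 0%N)%N by rewrite addn_gt0 g0 orbT.
  move=> xq; split=> [xd|gd]; last by rewrite -!addnS -gd addnS.
  have /eqP : (s + g 0%N = (s + d).+1)%N by exact: inv_itv_inj xq xd.
  by rewrite -addnS eqn_add2l => /eqP.
move=> xq.
have xE : 1 - (s + g 0%N)%:R * pierce s g = pierce (s + g 0%N) (shift g) :> R.
  rewrite [X in _ * X]pierce_rec// mulrCA divff ?pnatr_eq0 -?lt0n//; lra.
have g0E : (s + (g 0%N).-1).+1 = (s + g 0%N)%N by rewrite -addnS prednK// g0.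
split.
  move=> [j _ [xj]].
  have <- : (s + g 0%N = (s + j).+1)%N by exact: inv_itv_inj xq xj.
  rewrite /preimage/= xE => /ih; apply; exact: posseq_shift.
(* Branch [j] of the union stands for the first digit [j + 1]. *)
move=> gd; exists (g 0%N).-1 => //; rewrite g0E; split => //.
by rewrite /preimage/= xE; apply/ih => //; exact: posseq_shift.
Qed.

(** For consecutive a, b, c, 1/(abc) is half of 1/(ab) - 1/(bc). This half is the factor gained per
    digit in [lebesgue_digit_set_le]. *)
Lemma telescope_inv3_le (s m : nat) :
  \sum_(0 <= j < m) ((s + j).+1%:R^-1 *
     ((s + j).+2%:R * (s + j).+3%:R)^-1) <= (2 * (s.+1%:R * s.+2%:R))^-1 :> R.
Proof.
pose u (j : nat) : R := - (2 * ((s + j).+1%:R * (s + j).+2%:R))^-1.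
have uE j : (s + j).+1%:R^-1 * ((s + j).+2%:R * (s + j).+3%:R)^-1 =
    u j.+1 - u j.
  have x1 : (s + j).+1%:R != 0 :> R by rewrite pnatr_eq0.
  have x2 : (s + j).+2%:R != 0 :> R by rewrite pnatr_eq0.
  have x3 : (s + j).+3%:R != 0 :> R by rewrite pnatr_eq0.
  rewrite /u addnS -(natr1 (s + j).+2) -(natr1 (s + j).+1) in x2 x3 *.
  by move: (_.+1%:R) x1 x2 x3 => t x1 x2 x3; field; rewrite x1 x2 x3.
under eq_bigr do rewrite uE.
rewrite telescope_sumr// /u addn0 opprK.
by rewrite gerDr oppr_le0 invr_ge0 !mulr_ge0.
Qed.

(* A uniform point of ]0, 1/(s+1)[ has first Pierce digit r > s with
   probability (s+1)/(r(r+1)), and the mean of 1/(r+2) is then half of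
   1/(s+2). *)
Lemma lebesgue_digit_set_le d n s :
  (@lebesgue_measure R (digit_set d n s) <=
   (2^-1 ^+ n / (s.+1%:R * s.+2%:R))%:E)%E.
Proof.
elim: n s => [|n ih] s.
  rewrite /= lebesgue_measure_itv/= lte_fin ltf_pV2 ?posrE ?ltr0n//.
  rewrite ltr_nat ltnS leqnn -EFinB lee_fin expr0 mul1r.
  have -> : (s + d).+1%:R^-1 - (s + d).+2%:R^-1 =
      ((s + d).+1%:R * (s + d).+2%:R)^-1 :> R.
    have x1 : (s + d).+1%:R != 0 :> R by rewrite pnatr_eq0.
    have x2 : (s + d).+2%:R != 0 :> R by rewrite pnatr_eq0.
    rewrite -(natr1 (s + d).+1) in x2 *.
    by move: (_.+1%:R) x1 x2 => t x1 x2; field; rewrite x1 x2.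
  rewrite lef_pV2 ?posrE ?mulr_gt0// -!natrM ler_nat.
  by rewrite leq_mul// !ltnS leq_addr.
have mF (j : nat) : measurable ((fun x : measurableTypeR R =>
    1 - (s + j).+1%:R * x : measurableTypeR R) @^-1` digit_set d n (s + j).+1).
  rewrite -[X in measurable X]setTI.
  apply: (measurable_affine 1 (s + j).+1%:R) => //.
  exact: measurable_digit_set.
(* Dropping the intervals enlarges each branch to a full affine preimage, whose measure is scaled by
   [1/(s + j + 1)]. *)
apply: le_trans.
  apply: (measure_sigma_subadditive lebesgue_measure mF).
    exact: (measurable_digit_set d n.+1 s).
  by move=> x [j _ [_ xj]]; exists j.
apply: le_trans.
  apply: (@lee_nneseries _ _ (fun j => ((s + j).+1%:R^-1 *
      (2^-1 ^+ n / ((s + j).+2%:R * (s + j).+3%:R)))%:E)) => // j _.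
  rewrite [leLHS]lebesgue_measure_affine ?ltr0n//; last first.
    exact: measurable_digit_set.
  by rewrite EFinM lee_wpmul2l// lee_fin invr_ge0.
apply: lime_le.
  apply: is_cvg_nneseries => j _ _.
  by rewrite lee_fin !mulr_ge0 ?invr_ge0 ?exprn_ge0.
apply: nearW => m; rewrite sumEFin lee_fin.
under eq_bigr do rewrite mulrCA.
rewrite -mulr_sumr exprSr -mulrA -invfM ler_wpM2l ?exprn_ge0 ?invr_ge0//.
exact: telescope_inv3_le.
Qed.

End DigitSets.

(** * The shift on digit sets, and Borel-Cantelli *)

Section ShiftInvariance.
Context {R : realType}.
Implicit Types (d n : nat) (x : R).

Lemma measurable_rat : measurable (range (ratr : rat -> measurableTypeR R)).
Proof.
apply: countable_measurable; first exact: measurable_set1.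
exact: sub_countable (card_image_le _ _) (countableP _).
Qed.

Lemma irrationalE : [set x : R | irrational x] = ~` range ratr.
Proof.
apply/seteqP; split => x /= irrx.
  by move=> [q _ qx]; apply irrx; exists q.
by move=> [q xq]; apply: irrx; exists q.
Qed.

Lemma OdigitsP x : irrational x -> 0 < x < 1 ->
  posseq (Odigits x) /\ Obar (Odigits x) = x.
Proof.
move=> irrx x01; rewrite /Odigits; case: pselect => [h|]; first by case: cid.
by case; exact: irrational_Obar.
Qed.

(** Whichever expansion [Odigits] chooses, its digits are determined by the position of [x]. *)
Lemma digit_setE d n x : irrational x -> 0 < x < 1 ->
  digit_set d n 0 x <-> Odigits x n = d.+1.
Proof.
move=> irrx x01; have [g0 gx] := OdigitsP _ irrx x01.
by rewrite -{1}gx Obar_pierce; exact: pierce_digit_set.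
Qed.

(** Rationals are sent to the default value 0, which lies in no digit set, so they must be removed
    on the right. *)
Lemma preimage_Tshift_digit_set d n :
  Tshift @^-1` digit_set d n 0 = digit_set d n.+1 0 `\` range (ratr : rat -> R).
Proof.
rewrite setDE -irrationalE; apply/seteqP; split => x /=; rewrite /Tshift.
  case: asboolP => [[irrx x01]|_].
    have [g0 gx] := OdigitsP _ irrx x01.
    rewrite Obar_pierce => /pierce_digit_set xd; split => //.
    apply/(digit_setE d n.+1 x irrx x01); apply: xd; exact: posseq_shift.
  by move=> /digit_set_sub01; rewrite /= in_itv/= ltxx.
move=> [xd irrx]; have := digit_set_sub01 _ n.+1 _ _ xd.
rewrite /= in_itv/= => x01; case: asboolP => [_|]; last by case.
have [g0 gx] := OdigitsP _ irrx x01.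
apply/pierce_digit_set; first exact: posseq_shift.
by apply/(digit_setE d n.+1 x irrx x01).
Qed.

Lemma digit_set_limsup0 d :
  lebesgue_measure (lim_sup_set (fun n => @digit_set R d n 0)) = 0%E.
Proof.
apply: lim_sup_set_cvg0 => [n|]; first exact: measurable_digit_set.
apply: (@le_lt_trans _ _ 1%:E); last exact: ltry.
(* At offset 0 the measure bound is [2^-(n+1)], a series with sum 1. *)
apply: le_trans (@epsilon_trick0 R 1 xpredT ler01).
apply: lee_nneseries => // n _.
apply: le_trans (lebesgue_digit_set_le _ _ _) _.
by rewrite lee_fin mul1r mul1r natrX exprS invfM exprVn mulrC.
Qed.

End ShiftInvariance.

(* No Borel probability measure nu on [0,1] (a probability measure on the
   Borel sets of R concentrated on [0,1]) is T-invariant, T-ergodic and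
   absolutely continuous w.r.t. Lebesgue measure. *)
Theorem theorem4 (R : realType) :
  ~ exists nu : probability (measurableTypeR R) R,
      nu (~` `[0, 1]) = 0%E /\
      T_invariant nu /\ T_ergodic nu /\ nu `<< (@lebesgue_measure R).
Proof.
move=> [nu [nu01 [nuT [_ nuac]]]].
have nu0 (A : set (measurableTypeR R)) :
    measurable A -> lebesgue_measure A = 0%E -> nu A = 0%E.
  move=> mA /(measure0_null_setP lebesgue_measure mA)/nuac.
  by move=> /(measure0_null_setP nu mA).
have nuQ : nu (range ratr) = 0%E.
  by apply: nu0; [exact: measurable_rat|exact: lebesgue_measure_rat].
(* Invariance equates consecutive digit sets up to the rationals, which are [nu]-null by absolute
   continuity. *)
have nu_digit d n : nu (digit_set d n 0) = nu (digit_set d 0 0).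
  elim: n => [//|n <-]; rewrite -[RHS]nuT; last exact: measurable_digit_set.
  rewrite preimage_Tshift_digit_set.
  have mD := measurableD (measurable_digit_set d n.+1 0) (@measurable_rat R).
  apply/eqP; rewrite eq_le; apply/andP; split; last first.
    apply: le_measure; rewrite ?inE//.
    exact: (measurable_digit_set d n.+1 0).
  rewrite -[leRHS]adde0 -nuQ.
  apply: (le_trans _ (measureU2 nu mD (@measurable_rat R))).
  apply: le_measure; rewrite ?inE; first exact: (measurable_digit_set d n.+1 0).
    by apply: measurableU => //; exact: measurable_rat.
  by move=> x xd; have [xQ|xQ] := pselect (range ratr x); [right|left].
(* The constant mass of the digit sets is bounded by that of the tail unions, which decreases to the
   mass of the limsup by continuity from above. *)
have nu_digit0 d : nu (digit_set d 0 0) = 0%E.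
  have mC n := @measurable_digit_set R d n 0.
  have limsup0 : nu (lim_sup_set (fun n => digit_set d n 0)) = 0%E.
    apply: nu0; last exact: digit_set_limsup0.
    apply: bigcap_measurable => [|n _]; first by exists 0%N.
    by apply: bigcup_measurable.
  have mU n :
      measurable (\bigcup_(k in [set k | (n <= k)%N]) @digit_set R d k 0).
    by apply: bigcup_measurable.
  have : nu (\bigcup_(k in [set k | (n <= k)%N]) digit_set d k 0)
      @[n --> \oo] --> 0%E.
    rewrite -limsup0; apply: lim_sup_set_cvg => //.
    by apply: le_lt_trans (probability_le1 _ _) (ltry _).
  move=> cv; apply/eqP; rewrite eq_le measure_ge0 andbT.
  apply: (cvge_to_ge cv); apply: nearW => n; rewrite -(nu_digit d n).
  apply: le_measure; rewrite ?inE; [exact: mC|exact: mU|].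
  by move=> x xn; exists n => /=.
(* Every irrational of []0, 1[] has some first digit, and the endpoints 0 and 1 are rational; so
   three [nu]-null sets cover the line. *)
have cover : [set: measurableTypeR R] `<=`
    ~` `[0, 1] `|` range ratr `|` \bigcup_d digit_set d 0 0.
  move=> x _; case: (pselect (range ratr x)) => [|irrx]; first by left; right.
  have [x01|] := boolP (0 < x < 1); last first.
    move=> nx; left; left => /=; rewrite in_itv/= !le_eqVlt.
    move=> /andP[/predU1P[x0|x0] /predU1P[x1|x1]]; try apply: irrx.
    - by exists 0 => //; rewrite rmorph0.
    - by exists 0 => //; rewrite rmorph0.
    - by exists 1 => //; rewrite rmorph1.
    - by move: nx; rewrite x0 x1.
  right; have irr : irrational x.
    by move: irrx; rewrite -[~ _]/((~` _) x) -irrationalE.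
  have [g0 _] := OdigitsP _ irr x01.
  exists (Odigits x 0%N).-1 => //; apply/(digit_setE _ 0 x irr x01).
  by rewrite prednK.
have mI : measurable (~` `[0, 1] : set (measurableTypeR R)).
  by apply: measurableC; exact: measurable_itv.
have mU : measurable (\bigcup_d @digit_set R d 0 0).
  by apply: bigcupT_measurable => d; exact: measurable_digit_set.
have nuU : nu (\bigcup_d digit_set d 0 0) = 0%E.
  apply/eqP; rewrite eq_le measure_ge0 andbT.
  have mC d := @measurable_digit_set R d 0 0.
  apply: le_trans (measure_sigma_subadditive nu mC mU (@subset_refl _ _)) _.
  by rewrite eseries0// => d _ _; exact: nu_digit0.
have mQ := @measurable_rat R.
have : (nu setT <= 0)%E.
  apply: le_trans (le_measure nu _ _ cover) _; rewrite ?inE//.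
    by apply: measurableU => //; exact: measurableU.
  apply: le_trans (measureU2 _ (measurableU _ _ mI mQ) mU) _.
  rewrite [X in (_ + X)%E]nuU adde0; apply: le_trans (measureU2 _ mI mQ) _.
  by rewrite [X in (X + _)%E]nu01 [X in (_ + X)%E]nuQ adde0.
by rewrite probability_setT lee_fin ler10.
Qed.
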